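(* Let $n\ge 1$ and let $\alpha_1,\dots,\alpha_n$ be infinite ordinals with Cantor normal forms without multiplicities $\alpha_i=\sum_{j<l_i}\omega^{\alpha_{i,j}}$, $\alpha_{i,0}\ge\alpha_{i,1}\ge\dots\ge\alpha_{i,l_i-1}$. Let $X=\alpha_1\times\dots\times\alpha_n$, let $Sl(X)=\{0,\dots,l_1-1\}\times\dots\times\{0,\dots,l_n-1\}$ and $Gr(X)=\{s\in Sl(X): s(k)=0 \text{ for some } k\in[1,n]\}$. For $s\in Sl(X)$ let $X_s=\omega^{\alpha_{1,s(1)}}\times\dots\times\omega^{\alpha_{n,s(n)}}$. Then $$\mathbf{w}(X)=\bigoplus_{s\in Gr(X)}\mathbf{w}(X_s).$$
   Context: Products of ordinals have the componentwise order. The width $\mathbf{w}(A)$ of a wqo $A$ is the rank of the forest of nonempty finite sequences of pairwise incomparable elements of $A$ ordered by initial segment. $\oplus$ is the natural (Hessenberg) sum. ($X_s$ is isomorphic to the ''slice'' of $X$ consisting of tuples whose $i$-th coordinate lies in $[\sum_{j<s(i)}\omega^{\alpha_{i,j}},\sum_{j\le s(i)}\omega^{\alpha_{i,j}})$.) *)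

(* Defs.v *)
From mathcomp Require Import all_boot.
From Stdlib Require List.
From Stdlib Require Import ClassicalEpsilon.

Set Implicit Arguments.
Unset Strict Implicit.
Unset Printing Implicit Defensive.

(* Ordinal values: Aczel/Brouwer-style ordinals.  [osup I f] denotes the     *)
(* least ordinal strictly greater than every [f i].                          *)
Inductive Ord : Type := osup : forall (I : Type), (I -> Ord) -> Ord.

Fixpoint ole (x y : Ord) {struct x} : Prop :=
  match x, y with
  | @osup IA f, @osup JB g => forall i : IA, exists j : JB, ole (f i) (g j)
  end.

Definition olt (x y : Ord) : Prop :=
  match y with @osup JB g => exists j : JB, ole x (g j) end.

Definition oeq (x y : Ord) : Prop := ole x y /\ ole y x.

Definition ozero : Ord := osup (fun e : Empty_set => match e with end).

(* Natural (Hessenberg) sum:  x (+) y is the least ordinal strictly above all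
   x' (+) y and x (+) y' with x' < x, y' < y. *)
Fixpoint nsum (x y : Ord) {struct x} : Ord :=
  match x with
  | @osup IA f =>
    (fix inner (y : Ord) : Ord :=
       match y with
       | @osup JB g =>
         osup (fun k : IA + JB =>
                 match k with
                 | inl i => nsum (f i) (osup g)
                 | inr j => inner (g j)
                 end)
       end) y
  end.

Record POrd := { pcar :> Type; ple : pcar -> pcar -> Prop }.

Definition plt (P : POrd) (x y : P) : Prop := ple x y /\ ~ ple y x.

Definition is_wellorder (P : POrd) : Prop :=
  [/\ (forall x : P, ple x x),
      (forall x y z : P, ple x y -> ple y z -> ple x z),
      (forall x y : P, ple x y -> ple y x -> x = y),
      (forall x y : P, ple x y \/ ple y x)
    & well_founded (@plt P)].

Definition infinite_po (P : POrd) : Prop :=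
  exists f : nat -> P, injective f.

Definition po_iso (P Q : POrd) : Prop :=
  exists f : P -> Q, bijective f /\ forall x y : P, ple x y <-> ple (f x) (f y).

Definition ord_le (P Q : POrd) : Prop :=
  exists f : P -> Q, (forall x y : P, ple x y <-> ple (f x) (f y)) /\
    (forall (x : P) (b : Q), plt b (f x) -> exists a : P, f a = b).

(* omega ^ B : finite non-increasing sequences of elements of B, ordered     *)
(* lexicographically (Cantor normal form representation).                   *)
Fixpoint nonincr (B : POrd) (s : seq B) : Prop :=
  match s with
  | x :: ((y :: _) as t) => ple y x /\ nonincr t
  | _ => True
  end.

Fixpoint lexlt (B : POrd) (s t : seq B) : Prop :=
  match s, t with
  | [::], _ :: _ => True
  | x :: s', y :: t' => plt x y \/ (x = y /\ lexlt s' t')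
  | _, _ => False
  end.

Definition opow (B : POrd) : POrd :=
  {| pcar := {s : seq B | nonincr s};
     ple := fun s t => s = t \/ lexlt (proj1_sig s) (proj1_sig t) |}.

Definition osum (l : nat) (F : 'I_l -> POrd) : POrd :=
  {| pcar := {j : 'I_l & F j};
     ple := fun p q => p = q \/ (tag p < tag q)%N \/
              exists (j : 'I_l) (x y : F j),
                p = existT _ j x /\ q = existT _ j y /\ plt x y |}.

Definition prodpo (n : nat) (A : 'I_n -> POrd) : POrd :=
  {| pcar := forall i : 'I_n, A i;
     ple := fun x y => forall i, ple (x i) (y i) |}.

(* Width: rank of the tree (forest + root [::]) of finite sequences of       *)
(* pairwise incomparable elements, ordered by initial segment.               *)
Definition incomp (P : POrd) (x y : P) : Prop := ~ ple x y /\ ~ ple y x.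

Fixpoint antichain (P : POrd) (s : seq P) : Prop :=
  match s with
  | [::] => True
  | x :: t => (forall y, List.In y t -> incomp x y) /\ antichain t
  end.

Definition is_rank_fun (P : POrd) (h : seq P -> Ord) : Prop :=
  forall s : seq P, antichain s ->
    oeq (h s) (osup (fun x : {x : P | antichain (rcons s x)} =>
                       h (rcons s (proj1_sig x)))).

(* rank of the forest of nonempty antichain sequences = rank of its root [::] *)
Definition is_width (P : POrd) (o : Ord) : Prop :=
  exists h : seq P -> Ord, is_rank_fun h /\ oeq (h [::]) o.

Definition width (P : POrd) : Ord :=
  epsilon (inhabits ozero) (is_width P).

Definition Gr (n : nat) (l : 'I_n -> nat) : {set {dffun forall i : 'I_n, 'I_(l i)}} :=
  [set s : {dffun forall i : 'I_n, 'I_(l i)} | [exists i : 'I_n, nat_of_ord (s i) == 0%N]].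

(* Main.v *)
Require Import Defs.
From mathcomp Require Import all_boot.
From Stdlib Require Import ClassicalEpsilon ProofIrrelevance FunctionalExtensionality.
From Stdlib Require Import Morphisms.

(** Upper bound: slices [s] and [s + (m,...,m)] with [m > 0] are elementwise
    comparable, and [X_(s + (m,...,m))] embeds in [X_s] because the exponents
    decrease.  So the union of the slices on the diagonal through [s] in [Gr]
    has width at most [w(X_s)], and these diagonals cover [X].

    Lower bound: each [w(X_s)] is additively indecomposable, so the slices of
    [Gr] may be played one after the other, by increasing width and, for equal
    widths, starting with those furthest from the origin.  A point already played
    in a slice [s] before [t] has [s(i) > t(i)] for some [i], so it is not below
    any point of [X_t]; moving the coordinates [k] with [t(k) = 0] into a final
    segment of [omega^(alpha_(k,0))] makes it not above them either.

    Indecomposability of [w(prod_i omega^(b_i))] is by induction on the [b_i]: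
    the residual of a point is covered by finitely many products in which one
    factor is smaller, and as soon as two factors are infinite, any finite number
    of copies of such a product can be played inside the original one, by the
    same argument. *)

Set Implicit Arguments.
Unset Strict Implicit.
Unset Printing Implicit Defensive.

(** * Ordinals and the natural sum *)

Lemma ole_refl x : ole x x.
Proof. by elim: x => I f IH /= i; exists i. Qed.

Lemma ole_trans y x z : ole x y -> ole y z -> ole x z.
Proof.
elim: x y z => I f IH [J g] [K h] /= Hxy Hyz i.
have [j Hj] := Hxy i; have [k Hk] := Hyz j.
by exists k; apply: IH Hj Hk.
Qed.

Lemma olt_ole x y : olt x y -> ole x y.
Proof.
elim: x y => I f IH [J g] /= [j Hj] i; exists j; apply: IH.
by case: (g j) Hj => K h /(_ i).
Qed.

Lemma ole_olt_trans y x z : ole x y -> olt y z -> olt x z.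
Proof. by case: z => K h Hxy [k Hk]; exists k; apply: ole_trans Hxy Hk. Qed.

Lemma olt_ole_trans y x z : olt x y -> ole y z -> olt x z.
Proof.
case: y => J g; case: z => K h [j Hj] /(_ j) [k Hk].
by exists k; apply: ole_trans Hj Hk.
Qed.

Lemma olt_branch I (f : I -> Ord) i : olt (f i) (osup f).
Proof. by exists i; apply: ole_refl. Qed.

Lemma olt_wf : well_founded olt.
Proof.
(* A predecessor of [y] is only known to be [ole] some branch of [x], not equal to it, so
   accessibility is proved for everything below [x] at once. *)
suff H x y : ole y x -> Acc olt y by move=> x; apply: (H x); apply: ole_refl.
elim: x y => I f IH y Hy; constructor=> z Hz.
by have [i Hi] := olt_ole_trans Hz Hy; apply: (IH i).
Qed.

Lemma ole_or_olt x y : ole x y \/ olt y x.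
Proof.
elim: x y => I f IH y.
have [[i Hi]|N] := classic (exists i, ole y (f i)); first by right; exists i.
left; case: y N => J g N i.
(* If [f i] lies below no [g j], then by induction every [g j] is strictly below [f i], so that [y]
   is at most [f i], against [N]. *)
have [//|H] := classic (exists j, ole (f i) (g j)); case: N; exists i.
have {}IH j : olt (g j) (f i) by case: (IH i (g j)) => // Hj; case: H; exists j.
by case: (f i) IH.
Qed.

Lemma olt_irr x : ~ olt x x.
Proof. by elim/(well_founded_ind olt_wf): x => x IH H; apply: (IH x). Qed.

Lemma ole_ozero x : ole ozero x.
Proof. by case: x => I f []. Qed.

Instance oeq_equiv : Equivalence oeq.
Proof.
split=> [x|x y []|x y z [H1 H2] [H3 H4]] //; first by split; apply: ole_refl.
by split; [apply: ole_trans H1 H3|apply: ole_trans H4 H2].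
Qed.

#[local] Hint Extern 0 (ole ?x ?x) => apply: ole_refl : core.
#[local] Hint Extern 0 (oeq ?x ?x) => reflexivity : core.

Instance ole_oeq : Proper (oeq ==> oeq ==> iff) ole.
Proof.
move=> x x' [H1 H2] y y' [H3 H4]; split=> H.
  by apply: ole_trans H2 (ole_trans H H3).
by apply: ole_trans H1 (ole_trans H H4).
Qed.

Instance olt_oeq : Proper (oeq ==> oeq ==> iff) olt.
Proof.
move=> x x' [H1 H2] y y' [H3 H4]; split=> H.
  exact: ole_olt_trans H2 (olt_ole_trans H H3).
exact: ole_olt_trans H1 (olt_ole_trans H H4).
Qed.

Lemma nsum_ole x x' y y' : ole x x' -> ole y y' -> ole (nsum x y) (nsum x' y').
Proof.
elim: x x' y y' => I f IHx [I' f'] y y' Hx.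
elim: y y' => J g IHy [J' g'] Hy [i|j].
  by have [i' Hi] := Hx i; exists (inl i'); apply: IHx.
by have [j' Hj] := Hy j; exists (inr j'); apply: IHy.
Qed.

Instance nsum_oeq : Proper (oeq ==> oeq ==> oeq) nsum.
Proof. by move=> x x' [H1 H2] y y' [H3 H4]; split; apply: nsum_ole. Qed.

Lemma nsumC x y : oeq (nsum x y) (nsum y x).
Proof.
suff H a b : ole (nsum a b) (nsum b a) by split; apply: H.
elim: a b => I f IHx; elim=> J g IHy [i|j].
  by exists (inr i); apply: (IHx i (osup g)).
by exists (inl j); apply: (IHy j).
Qed.

Lemma nsumA x y z : oeq (nsum x (nsum y z)) (nsum (nsum x y) z).
Proof.
elim: x y z => I f IHx; elim=> J g IHy; elim=> K h IHz; split.
  case=> [i|[j|k]].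
  - by exists (inl (inl i)); apply: (proj1 (IHx i (osup g) (osup h))).
  - by exists (inl (inr j)); apply: (proj1 (IHy j (osup h))).
  - by exists (inr k); apply: (proj1 (IHz k)).
case=> [[i|j]|k].
- by exists (inl i); apply: (proj2 (IHx i (osup g) (osup h))).
- by exists (inr (inl j)); apply: (proj2 (IHy j (osup h))).
- by exists (inr (inr k)); apply: (proj2 (IHz k)).
Qed.

Lemma nsum0o x : oeq (nsum ozero x) x.
Proof.
elim: x => J g IH; split; first by case=> [[]|j]; exists j; case: (IH j).
by move=> j; exists (inr j); case: (IH j).
Qed.

Lemma nsumCA x y z : oeq (nsum x (nsum y z)) (nsum y (nsum x z)).
Proof. by rewrite nsumA (nsumC x y) -nsumA. Qed.

Lemma olt_nsuml x x' y : olt x x' -> olt (nsum x y) (nsum x' y).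
Proof.
case: x' => I f [i Hi]; case: y => J g; exists (inl i).
by apply: nsum_ole => //; apply: ole_refl.
Qed.

Lemma olt_nsumr x y y' : olt y y' -> olt (nsum x y) (nsum x y').
Proof. by move=> H; rewrite (nsumC x y) (nsumC x y'); apply: olt_nsuml. Qed.

Lemma olt_nsumP z x y : olt z (nsum x y) ->
  (exists2 x', olt x' x & ole z (nsum x' y)) \/
  (exists2 y', olt y' y & ole z (nsum x y')).
Proof.
case: x => I f; case: y => J g [[i|j] H].
  by left; exists (f i) => //; apply: olt_branch.
by right; exists (g j) => //; apply: olt_branch.
Qed.

Definition indec (w : Ord) : Prop :=
  forall x y, olt x w -> olt y w -> olt (nsum x y) w.

Lemma big_nsum_cat (K : Type) (W : K -> Ord) s t :
  oeq (\big[nsum/ozero]_(k <- s ++ t) W k)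
      (nsum (\big[nsum/ozero]_(k <- s) W k) (\big[nsum/ozero]_(k <- t) W k)).
Proof.
elim: s => [|k s IH] /=; first by rewrite big_nil nsum0o.
by rewrite !big_cons IH nsumA.
Qed.

Lemma big_nsum_perm (K : eqType) (W : K -> Ord) s t : perm_eq s t ->
  oeq (\big[nsum/ozero]_(k <- s) W k) (\big[nsum/ozero]_(k <- t) W k).
Proof.
move=> Hst; pose R r := oeq (\big[nsum/ozero]_(k <- s) W k) (\big[nsum/ozero]_(k <- r) W k).
apply: (@catCA_perm_ind _ R _ s t Hst); last by rewrite /R.
by rewrite /R => r1 r2 r3 ->; rewrite !big_nsum_cat nsumCA.
Qed.

Lemma big_nsum_lt (K : eqType) (W W' : K -> Ord) (k : K) s :
  k \in s -> olt (W k) (W' k) -> (forall j, ole (W j) (W' j)) ->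
  olt (\big[nsum/ozero]_(j <- s) W j) (\big[nsum/ozero]_(j <- s) W' j).
Proof.
move=> + Hk Hle.
have Hs r : ole (\big[nsum/ozero]_(j <- r) W j) (\big[nsum/ozero]_(j <- r) W' j).
  elim: r => [|j r IH]; first by rewrite !big_nil; apply: ole_refl.
  by rewrite !big_cons; apply: nsum_ole.
elim: s => // j s IH; rewrite inE => /orP[/eqP<-|/IH {}IH]; rewrite !big_cons.
  exact: olt_ole_trans (olt_nsuml _ Hk) (nsum_ole (ole_refl _) (Hs s)).
exact: ole_olt_trans (nsum_ole (Hle j) (ole_refl _)) (olt_nsumr _ IH).
Qed.

(* The smallest of indecomposable summands can absorb a decrease of any other. *)
Lemma big_nsum_exchange (K : eqType) (W : K -> Ord) (s : seq K) h c :
  (forall k, indec (W k)) -> (forall k, k \in s -> ole h (W k)) ->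
  olt ozero h -> olt c (\big[nsum/ozero]_(k <- s) W k) ->
  exists2 h', olt h' h & ole (nsum h c) (nsum h' (\big[nsum/ozero]_(k <- s) W k)).
Proof.
move=> ind + h0; elim: s c => [|k s IH] c Hs; first by rewrite big_nil => -[[]].
rewrite big_cons => /olt_nsumP[[d Hd Hc]|[c' Hc' Hc]].
  have hk := Hs k (mem_head _ _).
  (* If [W k] is at most [h], then [d] is itself below [h] and trades places with it. Otherwise [h]
     and [d] are both below the indecomposable [W k], which absorbs their sum, and [h'] can be
     zero. *)
  have [Hk|Hk] := ole_or_olt (W k) h.
    exists d; first exact: olt_ole_trans Hd Hk.
    by apply: ole_trans (nsum_ole (ole_refl h) Hc) _; rewrite nsumCA; do 2!apply: nsum_ole => //.
  exists ozero => //; apply: ole_trans (nsum_ole (ole_refl h) Hc) _; rewrite nsum0o nsumA.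
  by apply: nsum_ole => //; apply/olt_ole/ind => //.
have Hs' j : j \in s -> ole h (W j) by move=> jk; apply: Hs; rewrite inE jk orbT.
have [h' hh' H] := IH c' Hs' Hc'.
exists h' => //; apply: ole_trans (nsum_ole (ole_refl h) Hc) _.
by rewrite nsumCA (nsumCA h'); apply: nsum_ole.
Qed.

(** Each summand is replaced by the largest one. Indexing the copies by [nseq _ tt] keeps only their
    number, the form in which [box_copies] bounds them. *)
Lemma big_nsum_max (s : seq Ord) : s <> [::] -> exists2 v, List.In v s &
  ole (\big[nsum/ozero]_(u <- s) u) (\big[nsum/ozero]_(k <- nseq (size s) tt) v).
Proof.
have H v r : (forall u, List.In u r -> ole u v) ->
    ole (\big[nsum/ozero]_(u <- r) u) (\big[nsum/ozero]_(k <- nseq (size r) tt) v).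
  elim: r => [|u r IH] Hr; first by rewrite !big_nil.
  rewrite /= !big_cons; apply: nsum_ole; first by apply: Hr; left.
  by apply: IH => ? ?; apply: Hr; right.
move=> s0; suff [v vs Hv] : exists2 v, List.In v s & forall u, List.In u s -> ole u v.
  by exists v => //; apply: H.
elim: s s0 => // v [_ _|u s /(_ ltac:(done)) [w ws Hw] _].
  by exists v; [left|move=> u [<-|[]]].
have [vw|wv] := ole_or_olt v w; first by exists w; [right|move=> x [<-|/Hw]].
exists v; [by left|move=> x [<-|/Hw xw] //].
exact: ole_trans xw (olt_ole wv).
Qed.

Lemma big_nsum_const (K : Type) (s : seq K) v :
  \big[nsum/ozero]_(k <- s) v = \big[nsum/ozero]_(k <- nseq (size s) tt) v.
Proof. by elim: s => [|k s IH]; rewrite ?big_nil //= !big_cons IH. Qed.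

(** * Games: bounds on the rank of the tree of antichains *)

(* [wge o A] and [wle o A] say that [o] is a lower, resp. upper, bound of the
   width of the subset [A]. *)
Fixpoint wge (o : Ord) (P : POrd) (A : P -> Prop) : Prop :=
  match o with @osup J f =>
    forall i, exists2 x, A x & wge (f i) (fun y => A y /\ incomp x y)
  end.

Fixpoint wle (o : Ord) (P : POrd) (A : P -> Prop) : Prop :=
  match o with @osup J f =>
    forall x, A x -> exists i, wle (f i) (fun y => A y /\ incomp x y)
  end.

(** Such a map sends antichain sequences of [A] to antichain sequences of [B]; it therefore carries
    lower bounds on the width forwards and upper bounds backwards. *)
Definition incmorph (P Q : POrd) (A : P -> Prop) (B : Q -> Prop) (f : P -> Q) :=
  (forall x, A x -> B (f x)) /\
  (forall x y, A x -> A y -> incomp x y -> incomp (f x) (f y)).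

Lemma incmorph_res (P Q : POrd) (A : P -> Prop) (B : Q -> Prop) f x :
  incmorph A B f -> A x ->
  incmorph (fun y => A y /\ incomp x y) (fun y => B y /\ incomp (f x) y) f.
Proof.
move=> [HB Hi] Ax; split=> [y [Ay xy]|y z [Ay _] [Az _]]; last exact: Hi.
by split; [apply: HB|apply: Hi].
Qed.

Lemma wge_morph o o' (P Q : POrd) (A : P -> Prop) (B : Q -> Prop) f :
  incmorph A B f -> ole o' o -> wge o A -> wge o' B.
Proof.
elim: o o' A B => I g IH [J h] A B Hf Ho HA j.
have [i Hi] := Ho j; have [x Ax Hx] := HA i; exists (f x); first by case: Hf => + _; apply.
exact: IH (incmorph_res Hf Ax) Hi Hx.
Qed.

Lemma wle_morph o o' (P Q : POrd) (A : P -> Prop) (B : Q -> Prop) f :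
  incmorph A B f -> ole o o' -> wle o B -> wle o' A.
Proof.
elim: o o' A B => I g IH [J h] A B Hf Ho HB x Ax.
have [i Hi] := HB (f x) (proj1 Hf x Ax); have [j Hj] := Ho i; exists j.
exact: IH (incmorph_res Hf Ax) Hj Hi.
Qed.

Lemma incmorph_sub (P : POrd) (A B : P -> Prop) : (forall x, A x -> B x) -> incmorph A B id.
Proof. by []. Qed.

Lemma wge_sub o o' (P : POrd) (A B : P -> Prop) :
  (forall x, A x -> B x) -> ole o' o -> wge o A -> wge o' B.
Proof. by move=> /incmorph_sub; apply: wge_morph. Qed.

Lemma wle_sub o o' (P : POrd) (A B : P -> Prop) :
  (forall x, A x -> B x) -> ole o o' -> wle o B -> wle o' A.
Proof. by move=> /incmorph_sub; apply: wle_morph. Qed.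

Lemma wge_lt o o' (P : POrd) (A : P -> Prop) : wge o A -> olt o' o ->
  exists2 x, A x & wge o' (fun y => A y /\ incomp x y).
Proof.
case: o => I f H [i Hi]; have [x Ax Hx] := H i; exists x => //.
by apply: wge_sub Hx.
Qed.

(** The moves supplied by [wge] are played against the answers supplied by [wle]. *)
Lemma wge_wle o o' (P : POrd) (A : P -> Prop) : wge o A -> wle o' A -> ole o o'.
Proof.
elim: o o' A => I f IH [J g] A Hge Hle i.
have [x Ax Hx] := Hge i; have [j Hj] := Hle x Ax.
by exists j; apply: IH Hx Hj.
Qed.

Definition wval (P : POrd) (A : P -> Prop) (o : Ord) : Prop := wle o A /\ wge o A.

Lemma wval_uniq (P : POrd) (A : P -> Prop) o o' : wval A o -> wval A o' -> oeq o o'.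
Proof. by move=> [l g] [l' g']; split; [apply: wge_wle g l'|apply: wge_wle g' l]. Qed.

Lemma wval_ext (P : POrd) (A B : P -> Prop) o :
  (forall x, A x <-> B x) -> wval A o -> wval B o.
Proof. by move=> AB [l g]; split; [apply: wle_sub l|apply: wge_sub g] => // x /AB. Qed.

Lemma wval_osup (P : POrd) (A B : P -> Prop) (g : {x | B x} -> Ord) :
  (forall x, A x <-> B x) ->
  (forall x, wval (fun y => A y /\ incomp (sval x) y) (g x)) -> wval A (osup g).
Proof.
move=> AB H; split=> [x /AB Bx|[x Bx]]; first by exists (exist _ x Bx); case: (H (exist _ x Bx)).
by exists x; [apply/AB|case: (H (exist _ x Bx))].
Qed.

Lemma wval_exists (P : POrd) (A : P -> Prop) o : wle o A -> exists v, wval A v.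
Proof.
elim: o A => I f IH A HA.
have H (x : {x | A x}) : {v | wval (fun y => A y /\ incomp (sval x) y) v}.
  apply: constructive_indefinite_description.
  by have [i Hi] := HA _ (svalP x); apply: IH Hi.
by exists (osup (fun x => sval (H x))); apply: wval_osup => // x; apply: svalP.
Qed.

(** A move in [C] belongs to one of the two pieces and lowers the summand of that piece, which is
    one step down in the natural sum. *)
Lemma wle_union a b (P : POrd) (A B C : P -> Prop) :
  wle a A -> wle b B -> (forall x, C x -> A x \/ B x) -> wle (nsum a b) C.
Proof.
elim: a b A B C => I f IHa; elim=> J g IHb A B C HA HB HC x Cx.
have [/HA[i Hi]|/HB[j Hj]] := HC x Cx.
  exists (inl i); apply: (IHa i (osup g) _ B _ Hi HB) => y [/HC[]]; tauto.
exists (inr j); apply: (IHb j A _ _ HA Hj) => y [/HC[]]; tauto.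
Qed.

Lemma wle_bigunion (K : eqType) (W : K -> Ord) (P : POrd) (X : K -> P -> Prop) (s : seq K) A :
  (forall k, k \in s -> wle (W k) (X k)) ->
  (forall x, A x -> exists2 k, k \in s & X k x) ->
  wle (\big[nsum/ozero]_(k <- s) W k) A.
Proof.
elim: s A => [|k s IH] A HW HA; first by rewrite big_nil => x /HA[].
rewrite big_cons; apply: (@wle_union _ _ _ (X k) (fun x => exists2 k, k \in s & X k x)).
- exact/HW/mem_head.
- by apply: IH => // j js; apply: HW; rewrite inE js orbT.
- by move=> x /HA[j]; rewrite inE => /orP[/eqP->|]; [left|right; exists j].
Qed.

Definition incomp_seq (P : POrd) (s : seq P) (y : P) := forall x, List.In x s -> incomp x y.

Lemma In_rcons (T : Type) (s : seq T) x y : List.In y (rcons s x) -> List.In y s \/ y = x.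
Proof. by rewrite -cats1 => H; case: (List.in_app_or _ _ _ H) => [|[<-|[]]]; [left|right]. Qed.

Lemma antichain_rcons (P : POrd) (s : seq P) x :
  antichain (rcons s x) <-> antichain s /\ incomp_seq s x.
Proof.
elim: s => [|y s IH] /=; first by split=> // _; split.
split=> [[Hy /IH[Hs Hx]]|[[Hy Hs] Hx]].
  split; first by split=> // z zs; apply: Hy; rewrite -cats1; apply/List.in_or_app; left.
  move=> z [<-|]; last exact: Hx.
  by apply: Hy; rewrite -cats1; apply/List.in_or_app; right; left.
split; last by apply/IH; split=> // z zs; apply: Hx; right.
by move=> z zs; have [/Hy|->] := In_rcons zs => //; apply: Hx; left.
Qed.

Lemma incomp_seq_rcons (P : POrd) (s : seq P) x y :
  incomp_seq s y /\ incomp x y <-> incomp_seq (rcons s x) y.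
Proof.
split=> [[Hs Hx] z zs|H]; first by have [/Hs|->] := In_rcons zs.
by split=> [z zs|]; apply: H; rewrite -cats1; apply/List.in_or_app; [left|right; left].
Qed.

Lemma wval_rank_step (P : POrd) (s : seq P) (h : seq P -> Ord) : antichain s ->
  (forall x, antichain (rcons s x) -> wval (incomp_seq (rcons s x)) (h (rcons s x))) ->
  wval (incomp_seq s) (osup (fun x : {x : P | antichain (rcons s x)} => h (rcons s (sval x)))).
Proof.
move=> Hs H; apply: wval_osup => [x|x]; first by rewrite antichain_rcons; tauto.
by apply: wval_ext (H _ (svalP x)) => y; rewrite incomp_seq_rcons.
Qed.

(** As [width] is an [epsilon] choice, two facts are needed: some rank function has root value [o],
    and the root value of any rank function is [o]. *)
Lemma width_wval (P : POrd) o : wval (fun _ : P => True) o -> oeq (width P) o.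
Proof.
move=> Ho; have [Hl _] := Ho; have ext A : (forall x : P, A x) -> forall v, wval A v -> oeq v o.
  by move=> HA v Hv; apply: wval_uniq Ho; apply: wval_ext Hv => x; split.
have nilP (x : P) : incomp_seq [::] x by [].
have Hw : is_width P o.
  pose h (s : seq P) := epsilon (inhabits ozero) (wval (incomp_seq s)).
  have H (s : seq P) : wval (incomp_seq s) (h s).
    by apply: epsilon_spec; apply: (@wval_exists _ _ o); apply: wle_sub Hl.
  exists h; split; last exact: (ext _ nilP _ (H _)).
  by move=> s Hs; apply: wval_uniq (H s) (wval_rank_step Hs (fun x _ => H (rcons s x))).
have [h [Hh <-]] : is_width P (width P) by apply: epsilon_spec; exists o.
(* The rank equation expresses [h s] through longer sequences; the induction is on an upper bound
   [v] of the residual, which drops with every new point. *)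
suff H v (s : seq P) : antichain s -> wle v (incomp_seq s) -> wval (incomp_seq s) (h s).
  by apply: (ext _ nilP); apply: (H o) => //; apply: wle_sub Hl.
elim: v s => I f IH s Hs Hv.
have : wval (incomp_seq s) (osup (fun x : {x : P | antichain (rcons s x)} => h (rcons s (sval x)))).
  apply: wval_rank_step => // x Hx.
  have [i Hi] := Hv x (proj2 (proj1 (antichain_rcons s x) Hx)).
  by apply: (IH i) => //; apply: wle_sub Hi => // y /incomp_seq_rcons.
have [l g] := Hh s Hs; move=> [L G].
by split; [apply: wle_sub L|apply: wge_sub G].
Qed.

(* If [r j k], the piece [X j] is played before [X k]: finitely many points of
   earlier pieces must not lower the width of later ones. *)
Lemma wge_stack (K : eqType) (W : K -> Ord) (P : POrd) (X : K -> P -> Prop) (r : rel K) (ks : seq K) :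
  (forall k, indec (W k)) -> (forall j k, r j k -> ole (W j) (W k)) ->
  (forall k Y, (forall y, List.In y Y -> exists2 j, r j k & X j y) ->
     wge (W k) (fun x => X k x /\ incomp_seq Y x)) ->
  pairwise r ks ->
  wge (\big[nsum/ozero]_(k <- ks) W k) (fun x => exists2 k, k \in ks & X k x).
Proof.
move=> ind mono Hge.
(* [Y] lists the points played so far, all in pieces that come before each of the remaining ones. *)
suff H Y : (forall y, List.In y Y -> forall k, k \in ks -> exists2 j, r j k & X j y) ->
    pairwise r ks ->
    wge (\big[nsum/ozero]_(k <- ks) W k) (fun x => (exists2 k, k \in ks & X k x) /\ incomp_seq Y x).
  by move=> /(H [::] ltac:(done)); apply: wge_sub => // x [].
elim: ks Y => [|k ks IH] Y HY; first by rewrite big_nil => _ [].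
rewrite pairwise_cons big_cons => /andP[/allP rk /[dup] pks /IH {}IH].
set rest := \big[_/_]_(_ <- ks) _ in IH *.
have : wge (W k) (fun x => X k x /\ incomp_seq Y x).
  by apply: Hge => y /HY; apply; apply: mem_head.
have {}HY y : List.In y Y -> forall j, j \in ks -> exists2 i, r i j & X i y.
  by move=> yY j jk; apply: (HY y yY); rewrite inE jk orbT.
have : ole (W k) (W k) by [].
(* [h] is what remains of the width of the current piece [k]. *)
move: {1 3 4}(W k) => h; elim/(well_founded_ind olt_wf): h Y HY => h IHh Y HY hk Hh.
(* When the current piece is used up, play moves on to the next ones. *)
have [h0|h0] := ole_or_olt h ozero.
  apply: wge_sub (IH Y HY); last by apply: ole_trans (nsum_ole h0 (ole_refl _)) _; rewrite nsum0o.
  by move=> x [[j jk Xj] Hx]; split=> //; exists j => //; rewrite inE jk orbT.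
have step h' c : olt h' h -> ole c (nsum h' rest) ->
    exists2 x, (exists2 j, j \in k :: ks & X j x) /\ incomp_seq Y x &
     wge c (fun y => ((exists2 j, j \in k :: ks & X j y) /\ incomp_seq Y y) /\ incomp x y).
  move=> hh' Hc; have [x [Xx Yx] Hx] := wge_lt Hh hh'.
  exists x; first by split=> //; exists k => //; apply: mem_head.
  apply: wge_sub (IHh h' hh' (rcons Y x) _ _ _) => //.
  - by move=> y [Hy /incomp_seq_rcons[]].
  - move=> y yY j jk; have [/HY|->] := In_rcons yY; first exact.
    by exists k => //; apply: rk.
  - exact: ole_trans (olt_ole hh') hk.
  - by apply: wge_sub Hx => // y [[]] *; split=> //; apply/incomp_seq_rcons.
have wrap o : (forall c, olt c o -> exists2 x, (exists2 j, j \in k :: ks & X j x) /\ incomp_seq Y x &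
     wge c (fun y => ((exists2 j, j \in k :: ks & X j y) /\ incomp_seq Y y) /\ incomp x y)) ->
     wge o (fun x => (exists2 j, j \in k :: ks & X j x) /\ incomp_seq Y x).
  by case: o => I f H i; apply/H/olt_branch.
(* If the decrease occurs in [rest], [big_nsum_exchange] charges it to [h] instead: the later pieces
   have widths at least [W k], hence at least [h]. The move is thus always made in piece [k]. *)
apply: wrap => c /olt_nsumP[[h' hh' Hc]|[c' Hc' Hc]]; first exact: step hh' Hc.
have [|h' hh' H] := big_nsum_exchange ind _ h0 Hc'.
  by move=> j /rk /mono; apply: ole_trans.
by apply: step hh' _; apply: ole_trans Hc H.
Qed.

(** * Linear orders and powers of omega *)

Definition is_linear (P : POrd) : Prop :=
  [/\ forall x : P, ple x x,
      forall x y z : P, ple x y -> ple y z -> ple x z,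
      forall x y : P, ple x y -> ple y x -> x = y
    & forall x y : P, ple x y \/ ple y x].

Lemma wellorder_linear P : is_wellorder P -> is_linear P.
Proof. by case. Qed.

Lemma plt_irr (P : POrd) (x : P) : ~ plt x x.
Proof. by case. Qed.

Lemma ple_plt_trans (P : POrd) (y x z : P) : is_linear P -> ple x y -> plt y z -> plt x z.
Proof. by move=> [_ tr _ _] xy [yz zy]; split=> [|zx]; [apply: tr yz|case: zy; apply: tr xy]. Qed.

Lemma plt_ple_trans (P : POrd) (y x z : P) : is_linear P -> plt x y -> ple y z -> plt x z.
Proof.
move=> [_ tr _ _] [xy yx] yz; split=> [|zx]; first exact: tr yz.
by case: yx; apply: tr yz zx.
Qed.

Lemma plt_trans (P : POrd) (y x z : P) : is_linear P -> plt x y -> plt y z -> plt x z.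
Proof. by move=> lin xy [yz _]; apply: plt_ple_trans xy yz. Qed.

Lemma ple_plt (P : POrd) (x y : P) : is_linear P -> ple x y <-> x = y \/ plt x y.
Proof.
move=> [r _ a _]; split=> [xy|[<-|[]] //].
by have [yx|yx] := classic (ple y x); [left; apply: a|right].
Qed.

Lemma ple_or_plt (P : POrd) (x y : P) : is_linear P -> ple x y \/ plt y x.
Proof.
move=> [_ _ _ tot]; have [xy|xy] := classic (ple x y); first by left.
by right; split=> //; case: (tot x y).
Qed.

Lemma mono_reflect (P Q : POrd) (A : P -> Prop) (g : P -> Q) : is_linear P ->
  (forall x y, A x -> A y -> plt x y -> plt (g x) (g y)) ->
  forall x y, A x -> A y -> ple (g x) (g y) -> ple x y.
Proof.
move=> lin mono x y Ax Ay gxy; have [//|yx] := ple_or_plt x y lin.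
by case: (mono y x Ay Ax yx).
Qed.

Lemma prod_incomp (n : nat) (A : 'I_n -> POrd) (x y : prodpo A) :
  (forall i, is_linear (A i)) -> incomp x y ->
  (exists i, plt (x i) (y i)) /\ (exists i, plt (y i) (x i)).
Proof.
move=> lin [xy yx]; split; apply: NNPP => N.
  by apply: yx => i; have [//|H] := ple_or_plt (y i) (x i) (lin i); case: N; exists i.
by apply: xy => i; have [//|H] := ple_or_plt (x i) (y i) (lin i); case: N; exists i.
Qed.

Lemma reflect_incmorph (P Q : POrd) (A : P -> Prop) (B : Q -> Prop) f :
  (forall x, A x -> B (f x)) ->
  (forall x y, A x -> A y -> ple (f x) (f y) -> ple x y) -> incmorph A B f.
Proof. by move=> AB H; split=> // x y Ax Ay [xy yx]; split=> /H; auto. Qed.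

Lemma lexlt_irr (F : POrd) (s : seq F) : ~ lexlt s s.
Proof. by elim: s => //= x s IH [/plt_irr|[_]]. Qed.

Lemma lexlt_trans (F : POrd) (t s u : seq F) : is_linear F ->
  lexlt s t -> lexlt t u -> lexlt s u.
Proof.
move=> lin; elim: t s u => [|y t IH] [|x s] [|z u] //= [xy|[-> st]] [yz|[<- tu]].
- by left; apply: plt_trans yz.
- by left.
- by left.
- by right; split=> //; apply: IH tu.
Qed.

Lemma lexlt_total (F : POrd) (s t : seq F) : is_linear F ->
  s = t \/ lexlt s t \/ lexlt t s.
Proof.
move=> lin; elim: s t => [|x s IH] [|y t] /=; [by left|by right; left|by right; right|].
have [/(ple_plt _ _ lin)[->|xy]|yx] := ple_or_plt x y lin.
- by case: (IH t) => [->|[H|H]]; [left|right; left; right|right; right; right].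
- by right; left; left.
- by right; right; left.
Qed.

Lemma lexlt_cat2l (F : POrd) (p s t : seq F) : lexlt (p ++ s) (p ++ t) <-> lexlt s t.
Proof.
elim: p => //= x p <-; split=> [[/plt_irr//|[]//]|]; by right.
Qed.

Lemma opow_val_inj (F : POrd) (x y : opow F) : sval x = sval y -> x = y.
Proof. by case: x y => [s p] [t q] /= E; subst t; rewrite (proof_irrelevance _ p q). Qed.

Lemma opow_plt (F : POrd) (x y : opow F) : is_linear F -> plt x y <-> lexlt (sval x) (sval y).
Proof.
move=> lin; split=> [[[->|//] []]|xy]; first by left.
split; first by right.
by case=> [yx|/(lexlt_trans lin xy)/lexlt_irr //]; rewrite yx in xy; case: (lexlt_irr xy).
Qed.

Lemma opow_linear F : is_linear F -> is_linear (opow F).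
Proof.
move=> lin; split=> [x|x y z|x y|x y].
- by left.
- move=> [->//|xy] [<-|yz]; right=> //.
  exact: lexlt_trans yz.
- by move=> [//|xy] [->//|/(lexlt_trans lin xy)/lexlt_irr].
- have [/opow_val_inj->|[H|H]] := lexlt_total (sval x) (sval y) lin.
  + by left; left.
  + by left; right.
  + by right; right.
Qed.

Lemma nonincr_cons (F : POrd) (e : F) (s : seq F) : is_linear F ->
  nonincr (e :: s) <-> (forall d, List.In d s -> ple d e) /\ nonincr s.
Proof.
move=> [_ tr _ _]; elim: s e => [|d s IH] e //=; split.
  move=> [de /[dup] /IH[Hs _] H]; split=> // c [<-//|/Hs cd].
  exact: tr cd de.
by move=> [H1 H2]; split=> //; apply: H1; left.
Qed.

Lemma nonincr_cat (F : POrd) (s t : seq F) : is_linear F -> nonincr s -> nonincr t ->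
  (forall c d, List.In c s -> List.In d t -> ple d c) -> nonincr (s ++ t).
Proof.
move=> lin; elim: s => [|c s IH] // /(nonincr_cons _ _ lin)[Hc Hs] Ht H.
apply/(nonincr_cons _ _ lin); split; last by apply: IH => // *; apply: H => //; right.
by move=> d /(List.in_app_or s t) [/Hc|dt] //; apply: H => //; left.
Qed.

Lemma In_nseq (T : Type) j (e d : T) : List.In d (nseq j e) -> d = e.
Proof. by elim: j => //= j IH [|/IH]. Qed.

Lemma nonincr_nseq (F : POrd) (e : F) (j : nat) : is_linear F -> nonincr (nseq j e).
Proof.
move=> lin; elim: j => // j IH; apply/(nonincr_cons _ _ lin); split=> // d dj.
by rewrite (In_nseq dj); case: lin.
Qed.

(** This is division by [omega^e]: [j] is the quotient and [t] the remainder. *)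
Lemma nonincr_block (F : POrd) (e : F) (s : seq F) : is_linear F -> nonincr s ->
  (forall d, List.In d s -> ple d e) ->
  exists j t, s = nseq j e ++ t /\ forall d, List.In d t -> plt d e.
Proof.
move=> lin; elim: s => [|c s IH]; first by exists 0, [::].
move=> /(nonincr_cons _ _ lin)[Hc Hs] H.
have /(ple_plt _ _ lin)[ce|ce] : ple c e by apply: H; left.
  have [|j [t [-> Ht]]] := IH Hs; first by move=> d ds; apply: H; right.
  by exists j.+1, t; rewrite ce.
exists 0, (c :: s); split=> // d [<-//|/Hc dc].
exact: ple_plt_trans dc ce.
Qed.

(** A crude bound on the quotient by [omega^e]; it makes the cover in [small_residual] finite. *)
Lemma lexlt_block_size (F : POrd) (e : F) (j : nat) (t s : seq F) : (forall d, List.In d s -> ple d e) ->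
  lexlt (nseq j e ++ t) s -> j <= size s.
Proof.
elim: j s => // j IH [|d s] //= H [[_]|[_ /IH]]; first by case; apply: H; left.
by apply=> c cs; apply: H; right.
Qed.

Lemma lexlt_nseq (F : POrd) (e : F) (j : nat) (t s : seq F) : is_linear F -> (forall d, List.In d s -> ple d e) ->
  size s < j -> lexlt s (nseq j e ++ t).
Proof.
move=> lin; elim: s j => [|d s IH] [|j] //= H sj.
have [|->|de] := proj1 (ple_plt d e lin); [by apply: H; left| |by left].
by right; split=> //; apply: IH => // c cs; apply: H; right.
Qed.

(** The default value lets maps into [opow F] be written on raw sequences, with monotonicity of the
    sequence proved afterwards by [mkpowK]. *)
Definition mkpow (F : POrd) (s : seq F) : opow F :=
  match excluded_middle_informative (nonincr s) with
  | left H => exist _ s H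
  | right _ => exist (fun s => nonincr s) [::] Logic.I
  end.

Lemma mkpowK (F : POrd) (s : seq F) : nonincr s -> sval (mkpow s) = s.
Proof. by rewrite /mkpow; case: excluded_middle_informative. Qed.

Definition below (F : POrd) (b : option F) (e : F) : Prop :=
  if b is Some c then plt e c else True.

(** For [b = Some c] this is the initial segment [omega^c] of [opow F]; for [b = None] it is all of
    [opow F]. *)
Definition bounded (F : POrd) (b : option F) (x : opow F) : Prop :=
  forall e, List.In e (sval x) -> below b e.

Lemma below_ple (F : POrd) (b : option F) (d e : F) : is_linear F ->
  ple d e -> below b e -> below b d.
Proof. by move=> lin; case: b => //= c; apply: ple_plt_trans. Qed.

(** For [x] below [omega^e] this is the ordinal [omega^e * j + x], and [pow_drop j] takes it back to
    [x]. *)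
Definition pow_prefix (F : POrd) (j : nat) (e : F) (x : opow F) : opow F :=
  mkpow (nseq j e ++ sval x).

Definition pow_drop (F : POrd) (j : nat) (x : opow F) : opow F := mkpow (drop j (sval x)).

Lemma pow_prefixE (F : POrd) j (e : F) (x : opow F) : is_linear F -> bounded (Some e) x ->
  sval (pow_prefix j e x) = nseq j e ++ sval x.
Proof.
move=> lin Hx; apply: mkpowK; apply: nonincr_cat => //; [exact: nonincr_nseq|exact: (proj2_sig x)|].
by move=> c d cj dx; rewrite (In_nseq cj); case: (Hx d dx).
Qed.

Lemma pow_dropE (F : POrd) j (x : opow F) : is_linear F ->
  sval (pow_drop j x) = drop j (sval x).
Proof.
move=> lin; apply: mkpowK; have := svalP x; elim: j (sval x) => [|j IH] [|e s] //.
by move=> /(nonincr_cons _ _ lin)[_ /IH].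
Qed.

Lemma opow_max (F : POrd) (b : option F) (Y : seq (opow F)) : is_linear F ->
  (forall y, List.In y Y -> bounded b y) ->
  exists2 m, bounded b m & forall y, List.In y Y -> ple y m.
Proof.
move=> /opow_linear lin; elim: Y => [|y Y IH] H; first by exists (mkpow [::]) => // e; rewrite mkpowK.
have [|m bm Hm] := IH; first by move=> z zY; apply: H; right.
have by_ : bounded b y by apply: H; left.
have [ym|my] := ple_or_plt y m lin; first by exists m => // z [<-|/Hm].
exists y => // z [<-|/Hm zm]; first by case: lin.
by case: lin => _ tr _ _; case: my => my _; apply: tr zm my.
Qed.

(* An additively indecomposable ordinal embeds in each of its final segments. *)
Lemma opow_shift (F : POrd) (f0 : F) (b : option F) (Y : seq (opow F)) : is_linear F ->
  below b f0 -> (forall y, List.In y Y -> bounded b y) ->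
  exists g : opow F -> opow F,
    [/\ forall x, bounded b x -> bounded b (g x),
        forall x y, plt x y -> plt (g x) (g y)
      & forall x y, List.In y Y -> plt y (g x)].
Proof.
move=> lin bf0 HY; have [m bm Ym] := opow_max lin HY.
(* With [f] the leading exponent of [m], or [f0] if [m] is zero, [m] is below [omega^f * (M+1)]. The
   map [gs] is left addition of [omega^f * (M+1)], which is absorbed exactly when the leading
   exponent of the argument exceeds [f], the case [big]. *)
pose f := head f0 (sval m); pose M := (size (sval m)).
have bf : below b f by move: bm; rewrite /f /bounded; case: (sval m) => [|e s] // bm; apply: (bm e); left.
pose big s := if s is e :: _ then plt f e else False.
pose gs s := if excluded_middle_informative (big s) then s else nseq M.+1 f ++ s.
have gE (x : opow F) : sval (mkpow (gs (sval x))) = gs (sval x).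
  apply: mkpowK; rewrite /gs; case: excluded_middle_informative => H; first exact: (proj2_sig x).
  apply: nonincr_cat => //; [exact: nonincr_nseq|exact: (proj2_sig x)|].
  move=> c d cj dx; rewrite (In_nseq cj); move: (proj2_sig x) H dx; case: (sval x) => [|e s] //.
  move=> /(nonincr_cons _ _ lin)[He _] H.
  have ef : ple e f by have [|/H] := ple_or_plt e f lin.
  by case=> [<-//|/He de]; case: lin => _ tr _ _; apply: tr de ef.
exists (fun x : opow F => mkpow (gs (sval x))); split=> [x bx e|x y|x y yY].
- rewrite gE /gs; case: excluded_middle_informative => H; first exact: bx.
  by move=> ex; have [ef|/bx //] := List.in_app_or (nseq M.+1 f) (sval x) e ex; rewrite (In_nseq ef).
- rewrite !(opow_plt _ _ lin) !gE /gs.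
  case: excluded_middle_informative => Hx; case: excluded_middle_informative => Hy //.
  + case: (sval x) (sval y) Hx Hy => [|d s] // [|e t] //= Hd He [de|[de _]].
      by case: He; apply: plt_trans de.
    by case: He; rewrite -de.
  + by case: (sval y) Hy => // e t He _; left.
  + by move/(lexlt_cat2l (nseq M.+1 f)).
- apply: ple_plt_trans (Ym _ yY) _; first exact: opow_linear.
  apply/(opow_plt _ _ lin); rewrite gE /gs.
  case: excluded_middle_informative => Hx.
    by move: Hx; rewrite /big /f; case: (sval x) => [[]|e t]; case: (sval m) => [|d s] /=; [|left].
  apply: lexlt_nseq => // d; rewrite /f; move: (proj2_sig m); case: (sval m) => [|e s] //=.
  by move=> /(nonincr_cons _ _ lin)[He _] [<-|/He//]; case: lin.
Qed.

Definition pow_map (F G : POrd) (f : F -> G) (x : opow F) : opow G := mkpow [seq f e | e <- sval x].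

Lemma pow_map_mono (F G : POrd) (f : F -> G) : is_linear F -> is_linear G ->
  (forall x y : F, ple x y <-> ple (f x) (f y)) ->
  forall x y : opow F, plt x y -> plt (pow_map f x) (pow_map f y).
Proof.
move=> lF lG Hf x y; rewrite !opow_plt //.
have E z : sval (pow_map f z) = map f (sval z).
  apply: mkpowK; move: (proj2_sig z); elim: (sval z) => [|e s IH] // /(nonincr_cons _ _ lF)[He Hs].
  apply/(nonincr_cons _ _ lG); split; last exact: IH.
  by move=> d /List.in_map_iff[c [<- /He]] /Hf.
rewrite !E; elim: (sval x) (sval y) => [|d s IH] [|e t] //= [[de ed]|[-> /IH]]; last by right.
by left; split=> [|/Hf]; first apply/Hf.
Qed.

(** * Indecomposability *)

(** Ranks of exponents provide the measure for the induction in [box_indec]. *)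
Lemma rank_exists (P : POrd) : well_founded (@plt P) ->
  exists rk : P -> Ord, forall x y : P, plt x y -> olt (rk x) (rk y).
Proof.
move=> wf; pose step x (rec : forall y, plt y x -> Ord) :=
  osup (fun p : {y : P | plt y x} => rec (sval p) (proj2_sig p)).
exists (Fix wf (fun _ => Ord) step) => x y xy; rewrite [Fix _ _ _ y]Fix_eq.
  exact: (olt_branch (fun p : {z : P | plt z y} => Fix wf (fun _ => Ord) step (sval p)) (exist _ x xy)).
move=> z f g fg; congr osup; apply: functional_extensionality => p; exact: fg.
Qed.

Lemma wle_exists_step (P : POrd) (A : P -> Prop) :
  (forall x, A x -> exists o, wle o (fun y => A y /\ incomp x y)) -> exists o, wle o A.
Proof.
move=> HA; have H (x : {x | A x}) : {v | wle v (fun y => A y /\ incomp (sval x) y)}.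
  by apply: constructive_indefinite_description; apply: HA (proj2_sig x).
by exists (osup (fun x => sval (H x))) => x Ax; exists (exist _ x Ax); apply: (proj2_sig (H (exist _ x Ax))).
Qed.

Lemma wle_pos (P : POrd) (A : P -> Prop) o x : A x -> wle o A -> olt ozero o.
Proof. by case: o => I f Ax /(_ x Ax)[i _]; exists i; apply: ole_ozero. Qed.

Definition box (n : nat) (F : 'I_n -> POrd) (b : forall i, option (F i))
  (x : prodpo (fun i => opow (F i))) : Prop := forall i, bounded (b i) (x i).

(** Coordinate [i] is confined to the interval from [omega^e * j] to [omega^e * (j+1)], the upper
    end excluded. *)
Definition slice (n : nat) (F : 'I_n -> POrd) (b : forall i, option (F i)) (i : 'I_n) (e : F i)
    (j : nat) (x : prodpo (fun i => opow (F i))) : Prop :=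
  box b x /\ exists2 t, sval (x i) = nseq j e ++ t & forall d, List.In d t -> plt d e.

Section Boxes.
Context (n : nat) (F : 'I_n -> POrd).
Hypothesis linF : forall i, is_linear (F i).
Implicit Type b : forall i, option (F i).

Let linpow i : is_linear (opow (F i)) := opow_linear (linF i).

Lemma box_nil b : box b (fun i => mkpow [::]).
Proof. by move=> m d; rewrite mkpowK. Qed.

Lemma slice_to_box b i (e : F i) j :
  incmorph (slice b e j) (box (dfwith b (Some e)))
    (fun x => dfwith x (pow_drop j (x i)) : prodpo (fun i => opow (F i))).
Proof.
have drop_nseq (t : seq (F i)) : drop j (nseq j e ++ t) = t by rewrite drop_size_cat ?size_nseq.
apply: reflect_incmorph => [x [bx [t xt te]] k|x y [bx [s xs _]] [by_ [t yt _]] H k].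
  have [<-|ik] := eqVneq i k; last by rewrite !dfwith_out.
  by rewrite !dfwith_in => d; rewrite pow_dropE // xt drop_nseq; apply: te.
have := H k; have [<-|ik] := eqVneq i k; last by rewrite !dfwith_out.
rewrite !dfwith_in; apply: (@mono_reflect (opow (F i)) _ (fun z => exists t, sval z = nseq j e ++ t) (@pow_drop _ j)) => //.
- move=> u v [u' Hu] [v' Hv]; rewrite !opow_plt // !pow_dropE // Hu Hv !drop_nseq.
  by move/lexlt_cat2l.
- by exists s.
- by exists t.
Qed.

(** Points of [Y] lie in later slices, so they exceed every point of slice [j] in coordinate [i].
    Shifting coordinate [k] above all of [Y] by [opow_shift] makes the image incomparable to [Y]. *)
Lemma box_avoiding_to_slice b i k (e : F i) (f : F k) j (Y : seq (prodpo (fun i => opow (F i)))) :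
  i != k -> below (b i) e -> below (b k) f ->
  (forall y, List.In y Y -> exists2 j', j < j' & slice b e j' y) ->
  exists phi, incmorph (box (dfwith b (Some e))) (fun x => slice b e j x /\ incomp_seq Y x) phi.
Proof.
move=> ik be bf HY.
have [y|g [gb gmono gY]] := @opow_shift (F k) f (b k) [seq y k | y : prodpo _ <- Y] (linF k) bf.
  by move=> /List.in_map_iff[x [<- /HY[j' _ [bx _]]]].
pose phi (x : prodpo (fun i => opow (F i))) : prodpo (fun i => opow (F i)) :=
  dfwith (dfwith x (pow_prefix j e (x i))) (g (x k)).
have phii x : phi x i = pow_prefix j e (x i) by rewrite /phi dfwith_out 1?eq_sym // dfwith_in.
have phik x : phi x k = g (x k) by rewrite /phi dfwith_in.
have phio x m : i != m -> k != m -> phi x m = x m by move=> im km; rewrite /phi !dfwith_out.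
have bi x : box (dfwith b (Some e)) x -> bounded (Some e) (x i).
  by move=> /(_ i); rewrite dfwith_in.
have bk x : box (dfwith b (Some e)) x -> bounded (b k) (x k).
  by move=> /(_ k); rewrite dfwith_out.
exists phi; apply: reflect_incmorph => [x Hx|x y Hx Hy H m].
  have bx := bi x Hx; split; first split.
  - move=> m; have [<-|im] := eqVneq i m.
      rewrite phii => d; rewrite pow_prefixE // => dx.
      have [dj|/bx de] := List.in_app_or (nseq j e) _ d dx; first by rewrite (In_nseq dj).
      by apply: below_ple be => //; case: de.
    have [<-|km] := eqVneq k m; first by rewrite phik; apply/gb/bk.
    by rewrite phio //; have := Hx m; rewrite dfwith_out.
  - by exists (sval (x i)) => //; rewrite phii pow_prefixE.
  move=> y yY; have [j' jj' [by_ [t yt te]]] := HY y yY; split=> H.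
    have [_] : plt (phi x i) (y i).
      apply/opow_plt => //; rewrite phii pow_prefixE // yt -(subnKC (ltnW jj')) nseqD -catA.
      apply/lexlt_cat2l.
      have : 0 < j' - j by rewrite subn_gt0.
      case: (j' - j) => // r _; move: bx; rewrite /bounded.
      by case: (sval (x i)) => // d s bx; left; apply: (bx d); left.
    by apply; apply: H.
  have [_] : plt (y k) (phi x k).
    by rewrite phik; apply: gY; apply/List.in_map_iff; exists y.
  by apply; apply: H.
have := H m; have [<-|im] := eqVneq i m.
  rewrite !phii; apply: (@mono_reflect _ _ (bounded (Some e)) (pow_prefix j e)) => //; try exact: bi.
  by move=> u v Hu Hv; rewrite !opow_plt // !pow_prefixE // lexlt_cat2l.
have [<-|km] := eqVneq k m; last by rewrite !phio.
rewrite !phik; apply: (@mono_reflect _ _ (fun _ => True) g) => // u v _ _.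
exact: gmono.
Qed.

Definition small b (A : prodpo (fun i => opow (F i)) -> Prop) : Prop :=
  exists2 L : seq Ord,
    forall V, List.In V L -> exists i (e : F i),
      [/\ below (b i) e, wval (box (dfwith b (Some e))) V & indec V]
    & wle (\big[nsum/ozero]_(V <- L) V) A.

Lemma small_sub b A B : (forall x, A x -> B x) -> small b B -> small b A.
Proof. by move=> AB [L HL HB]; exists L => //; apply: wle_sub HB. Qed.

Lemma small_bigunion b (K : eqType) (s : seq K) X A :
  (forall k, k \in s -> small b (X k)) -> (forall x, A x -> exists2 k, k \in s & X k x) ->
  small b A.
Proof.
elim: s A => [|k s IH] A HX HA.
  by exists [::] => //; rewrite big_nil => x /HA[].
have [L1 HL1 H1] := HX k (mem_head _ _).
have [|//|L2 HL2 H2] := IH (fun x => exists2 k, k \in s & X k x).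
  by move=> j js; apply: HX; rewrite inE js orbT.
exists (L1 ++ L2); first by move=> V VL; have [/HL1|/HL2] := List.in_app_or L1 L2 V VL.
have : wle (nsum (\big[nsum/ozero]_(V <- L1) V) (\big[nsum/ozero]_(V <- L2) V)) A.
  apply: wle_union H1 H2 _ => x /HA[j]; rewrite inE => /orP[/eqP->|js]; first by left.
  by right; exists j.
by apply: wle_sub => //; case: (big_nsum_cat id L1 L2).
Qed.

(** A point incomparable to [z] is below [z] in some coordinate [i]. There its quotient by
    [omega^e], for [e] the leading exponent of [z i], takes finitely many values, and each value
    gives a slice that embeds in the box with bound [e] at [i]. *)
Lemma small_residual b z :
  (forall i (e : F i), below (b i) e ->
    exists2 V, wval (box (dfwith b (Some e))) V & indec V) ->
  box b z -> small b (fun y => box b y /\ incomp z y).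
Proof.
move=> IH bz.
apply: (@small_bigunion _ _ (enum 'I_n) (fun i y => box b y /\ plt (y i) (z i))); last first.
  move=> y [by_ /(prod_incomp linpow)[_ [i yz]]].
  by exists i; rewrite ?mem_enum.
(* If [z i] is zero, nothing lies below it in coordinate [i]. *)
move=> i _; case E : (sval (z i)) => [|e s].
  apply: (@small_sub _ _ (fun=> False)); last by exists [::] => //; rewrite big_nil.
  by move=> y [_]; rewrite opow_plt // E; case: (sval (y i)).
have be : below (b i) e by apply: bz; rewrite E; left.
have [He _] : (forall d, List.In d s -> ple d e) /\ nonincr s.
  by apply/nonincr_cons => //; rewrite -E; apply: (proj2_sig (z i)).
have {}He d : List.In d (e :: s) -> ple d e by case=> [<-|/He//]; case: (linF i).
apply: (@small_bigunion _ _ (iota 0 (size (e :: s)).+1) (fun j => slice b e j)).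
  move=> j _; have [V HV iV] := IH i e be.
  exists [:: V]; first by move=> _ [<-|[]]; exists i, e.
  rewrite big_cons big_nil; case: HV => HV _; apply: wle_morph (slice_to_box b e j) _ HV.
  by rewrite nsumC nsum0o.
move=> y [by_ yz]; have Hy d : List.In d (sval (y i)) -> ple d e.
  move: yz; rewrite opow_plt // E.
  case: (sval (y i)) (proj2_sig (y i)) => // c t /(nonincr_cons _ _ (linF i))[Hc _] /= ce.
  have {ce}ce : ple c e by case: ce => [[]|[-> _]] //; case: (linF i).
  by case=> [<-//|/Hc dc]; case: (linF i) => _ tr _ _; apply: tr dc ce.
have [j [t [yt te]]] := nonincr_block (linF i) (proj2_sig (y i)) Hy.
exists j; last by split=> //; exists t.
rewrite mem_iota add0n ltnS; apply: (lexlt_block_size He (t := t)).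
by rewrite -yt -E; apply/opow_plt.
Qed.

Lemma box_copies b i k (e : F i) (f : F k) V W N :
  i != k -> below (b i) e -> below (b k) f ->
  wval (box (dfwith b (Some e))) V -> indec V -> wval (box b) W ->
  olt (\big[nsum/ozero]_(j <- nseq N tt) V) W.
Proof.
move=> ik be bf [lV gV] iV [lW _].
have V0 : olt ozero V.
  by apply: wle_pos (box_nil _) lV.
(* The slices are played from the highest block down, as [box_avoiding_to_slice] requires. One slice
   more than the [N] copies makes the final inequality strict, since [V] is positive. *)
have H : ole (\big[nsum/ozero]_(j <- rev (iota 0 N.+1)) V) W.
  apply: wge_wle lW.
  have : wge (\big[nsum/ozero]_(j <- rev (iota 0 N.+1)) V)
             (fun x => exists2 j, j \in rev (iota 0 N.+1) & slice b e j x).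
    apply: (@wge_stack _ (fun=> V) _ _ gtn) => //.
      move=> j Y HY; have [phi Hphi] := box_avoiding_to_slice ik be bf HY.
      exact: wge_morph Hphi (ole_refl V) gV.
    by rewrite -sorted_pairwise ?rev_sorted ?iota_ltn_sorted // => x y z /= H1 H2; apply: ltn_trans H1.
  by apply: wge_sub => // x [j _ []].
apply: olt_ole_trans H; rewrite (big_nsum_const (rev _)) size_rev size_iota /= big_cons.
by have := olt_nsuml (\big[nsum/ozero]_(j <- nseq N tt) V) V0; rewrite nsum0o.
Qed.

Lemma box_indec_step b :
  (forall i (e : F i), below (b i) e ->
    exists2 V, wval (box (dfwith b (Some e))) V & indec V) ->
  exists2 W, wval (box b) W & indec W.
Proof.
move=> IH; have [o Ho] : exists o, wle o (box b).
  apply: wle_exists_step => z bz; have [L _ HL] := small_residual IH bz.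
  by exists (\big[nsum/ozero]_(V <- L) V).
have [W HW] := wval_exists Ho; exists W => //.
have W0 : olt ozero W.
  by case: HW => HW _; apply: wle_pos (box_nil _) HW.
(* A factor with an exponent below its bound is infinite; the question is whether two distinct
   factors are. *)
have [[i [k [e [f [ik be bf]]]]]|N] :=
  classic (exists i k (e : F i) (f : F k), [/\ i != k, below (b i) e & below (b k) f]).
  have other m : exists k (f : F k), m != k /\ below (b k) f.
    have [<-|mi] := eqVneq i m; first by exists k, f.
    by exists i, e; rewrite eq_sym.
  (* Each [c] below [W] is at most the width of the residual of some point, hence at most a finite
     sum of ordinals all of whose finite multiples stay below [W]. Two such sums together are
     dominated by a multiple of their largest term. *)
  have bound c : olt c W -> exists2 L : seq Ord,
      forall V, List.In V L -> forall N, olt (\big[nsum/ozero]_(j <- nseq N tt) V) W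
      & ole c (\big[nsum/ozero]_(V <- L) V).
    move=> cW; have [lW gW] := HW; have [z bz Hz] := wge_lt gW cW.
    have [L HL Hle] := small_residual IH bz; exists L; last exact: wge_wle Hz Hle.
    move=> V /HL[m [d [bd HV iV]]] N; have [k' [f' [mk' bf']]] := other m.
    exact: box_copies mk' bd bf' HV iV HW.
  move=> c d /bound[L HL cL] /bound[L' HL' dL'].
  have : ole (nsum c d) (\big[nsum/ozero]_(V <- L ++ L') V).
    by rewrite big_nsum_cat; apply: nsum_ole.
  have {HL HL'} : forall V, List.In V (L ++ L') -> forall N, olt (\big[nsum/ozero]_(j <- nseq N tt) V) W.
    by move=> V VL; have [/HL|/HL'] := List.in_app_or L L' V VL.
  case: (L ++ L') => [_|V M HM] Hle; first by apply: ole_olt_trans Hle _; rewrite big_nil.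
  have [//|U /HM {}HM HU] := @big_nsum_max (V :: M).
  exact: ole_olt_trans Hle (ole_olt_trans HU (HM _)).
(* With at most one infinite factor the box is a chain, so [W] is 1. *)
have zero c : olt c W -> ole c ozero.
  move=> cW; have [_ gW] := HW; have [z bz Hz] := wge_lt gW cW.
  apply: wge_wle Hz _ => y [by_ /(prod_incomp linpow)[[i zy] [k yz]]].
  case: N; have wit m (u v : opow (F m)) : bounded (b m) v -> plt u v -> exists e, below (b m) e.
    rewrite opow_plt // => bv; case E : (sval v) => [|e s]; first by case: (sval u).
    by exists e; apply: bv; rewrite E; left.
  have [e be] := wit i _ _ (by_ i) zy; have [f bf] := wit k _ _ (bz k) yz.
  exists i, k, e, f; split=> //; apply/eqP => ik; subst k.
  by case: zy => _; apply; case: yz.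
move=> c d /zero c0 /zero d0; apply: ole_olt_trans W0.
by rewrite -(nsum0o ozero); apply: nsum_ole.
Qed.
End Boxes.

(** Induction on the natural sum of the ranks of the bounds, which strictly decreases when a single
    bound is lowered. *)
Lemma box_indec (n : nat) (F : 'I_n -> POrd) (b : forall i, option (F i)) :
  (forall i, is_wellorder (F i)) -> exists2 W, wval (box b) W & indec W.
Proof.
move=> wo; have lin i := wellorder_linear (wo i).
have rkP i : exists rk : F i -> Ord, forall x y, plt x y -> olt (rk x) (rk y).
  by apply: rank_exists; case: (wo i).
pose rk i := sval (constructive_indefinite_description _ (rkP i)).
have rk_lt i (x y : F i) : plt x y -> olt (rk i x) (rk i y).
  exact: proj2_sig (constructive_indefinite_description _ (rkP i)) x y.
(* The bound [None] ranks above every exponent of [F i]. *)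
pose rko i (c : option (F i)) := if c is Some e then rk i e else osup (rk i).
pose mu (c : forall i, option (F i)) := \big[nsum/ozero]_(i <- enum 'I_n) rko i (c i).
move: {2}(mu b) (erefl (mu b)) => o; elim/(well_founded_ind olt_wf): o b => o IH b Eo.
apply: box_indec_step => // i e be; apply: (IH (mu (dfwith b (Some e)))) => //.
have lt_i : olt (rko i (Some e)) (rko i (b i)).
  by move: be; rewrite /rko; case: (b i) => [c /rk_lt|_] //; apply: olt_branch.
rewrite -Eo; apply: (@big_nsum_lt _ _ _ i); rewrite ?mem_enum ?dfwith_in // => j.
by have [<-|ij] := eqVneq i j; [rewrite dfwith_in; apply: olt_ole|rewrite dfwith_out].
Qed.

(** * The slices of a product of ordinals *)

Lemma width_prod_opow (n : nat) (F : 'I_n -> POrd) : (forall i, is_wellorder (F i)) ->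
  wval (fun _ : prodpo (fun i => opow (F i)) => True) (width (prodpo (fun i => opow (F i)))) /\
  indec (width (prodpo (fun i => opow (F i)))).
Proof.
move=> wo; have [W HW iW] := box_indec (fun i => None) wo.
have {}HW : wval (fun _ : prodpo (fun i => opow (F i)) => True) W.
  by apply: wval_ext HW => x; split.
have E := width_wval HW; split; last by move=> x y; rewrite E; apply: iW.
by case: HW E => lW gW [E1 E2]; split; [apply: wle_sub lW|apply: wge_sub gW].
Qed.

Lemma osum_ple_tag (l : nat) (F : 'I_l -> POrd) (p q : osum F) : ple p q -> tag p <= tag q.
Proof. by case=> [->|[/ltnW|[j [x [y [-> [-> _]]]]]]]. Qed.

Lemma osum_plt_tag (l : nat) (F : 'I_l -> POrd) (p q : osum F) : tag p < tag q -> plt p q.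
Proof.
move=> pq; split; first by right; left.
by move/osum_ple_tag; rewrite leqNgt pq.
Qed.

Lemma osum_ple (l : nat) (F : 'I_l -> POrd) j (x y : F j) : is_linear (F j) ->
  @ple (osum F) (existT _ j x) (existT _ j y) <-> ple x y.
Proof.
move=> lin; split=> [|/(ple_plt _ _ lin)[->|xy]]; last 2 first.
- by left.
- by right; right; exists j, x, y.
case=> [xy|[|[k [u [v [xu [yv [uv _]]]]]]]].
- by rewrite (inj_pair2 _ _ _ _ _ xy); case: lin.
- by rewrite /= ltnn.
- have jk : j = k by case: xu.
  by subst k; rewrite (inj_pair2 _ _ _ _ _ xu) (inj_pair2 _ _ _ _ _ yv).
Qed.

Lemma osum_plt (l : nat) (F : 'I_l -> POrd) j (x y : F j) : is_linear (F j) ->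
  @plt (osum F) (existT _ j x) (existT _ j y) <-> plt x y.
Proof. by move=> lin; rewrite /plt !osum_ple. Qed.

Lemma osum_linear (l : nat) (F : 'I_l -> POrd) : (forall j, is_linear (F j)) -> is_linear (osum F).
Proof.
move=> lin; split=> [x|x y z xy yz|x y xy yx|x y].
- by left.
- have := leq_trans (osum_ple_tag xy) (osum_ple_tag yz).
  rewrite leq_eqVlt => /orP[/eqP/val_inj E|]; last by move/osum_plt_tag => [].
  have E' : tag x = tag y.
    by apply/val_inj/eqP; rewrite eqn_leq (osum_ple_tag xy) E (osum_ple_tag yz).
  case: x y z xy yz E' E => [j x] [k y] [m z] xy yz jk jm.
  have {}jk : j = k := jk; have {}jm : j = m := jm; subst k m.
  move: xy yz; rewrite !osum_ple //; case: (lin j) => _ tr _ _; exact: tr.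
- have E : tag x = tag y by apply/val_inj/eqP; rewrite eqn_leq !osum_ple_tag.
  case: x y xy yx E => [j x] [k y] xy yx jk; have {}jk : j = k := jk; subst k.
  move: xy yx; rewrite !osum_ple //; case: (lin j) => _ _ a _ xy yx; congr existT; exact: a.
- have [H|H|/val_inj E] := ltngtP (tag x) (tag y).
  + by left; case: (osum_plt_tag H).
  + by right; case: (osum_plt_tag H).
  case: x y E => [j x] [k y] jk; have {}jk : j = k := jk; subst k.
  by rewrite !osum_ple //; case: (lin j).
Qed.

(** Extracts from [Y] the finite list in one summand above which [opow_shift] has to move. *)
Lemma osum_component (l : nat) (F : 'I_l -> POrd) (j : 'I_l) (Y : seq (osum F)) :
  exists Z : seq (F j), forall p, List.In p Y -> tag p = j ->
    exists2 z, List.In z Z & p = existT _ j z.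
Proof.
elim: Y => [|[k y] Y [Z HZ]]; first by exists [::].
have [jk|jk] := eqVneq k j.
  subst k; exists (y :: Z) => p [<-|/HZ H] pj; first by exists y; first left.
  by have [z zZ ->] := H pj; exists z => //; right.
exists Z => p [<- /= kj|/HZ //]; by rewrite kj eqxx in jk.
Qed.

Definition asbool (P : Prop) : bool := if excluded_middle_informative P then true else false.

Lemma asboolP P : reflect P (asbool P).
Proof. by rewrite /asbool; case: excluded_middle_informative => H; constructor. Qed.

(** The family is total in [j] and [k], with a constant map when [k < j], so that it can be applied
    to the tag of an arbitrary point. *)
Lemma exists_pow_emb (n : nat) (l : 'I_n -> nat) (E : forall i, 'I_(l i) -> POrd) :
  (forall i j, is_linear (@E i j)) ->
  (forall i (j k : 'I_(l i)), (j <= k)%N -> ord_le (@E i k) (@E i j)) ->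
  exists emb : forall i (j k : 'I_(l i)), opow (@E i k) -> opow (@E i j),
    forall i (j k : 'I_(l i)), j <= k -> forall x y, plt x y -> plt (emb i j k x) (emb i j k y).
Proof.
move=> lin dec.
have H i (j k : 'I_(l i)) : {f : opow (@E i k) -> opow (@E i j) |
    j <= k -> forall x y, plt x y -> plt (f x) (f y)}.
  apply: constructive_indefinite_description; have [/dec[f [Hf _]]|_] := leqP j k.
    by exists (pow_map f) => _; apply: pow_map_mono.
  by exists (fun _ => mkpow [::]).
by exists (fun i j k => sval (H i j k)) => i j k; apply: (proj2_sig (H i j k)).
Qed.

(** * The two bounds for the sum over [Gr] *)

Section GroundSlices.
Context (n : nat) (l : 'I_n -> nat) (E : forall i : 'I_n, 'I_(l i) -> POrd).
Arguments E : clear implicits.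
Hypothesis n_gt0 : 0 < n.
Hypothesis woE : forall i j, is_wellorder (E i j).
Arguments woE : clear implicits.
Hypothesis decE : forall i (j k : 'I_(l i)), (j <= k)%N -> ord_le (E i k) (E i j).
Arguments decE : clear implicits.
Hypothesis inhE : forall i (j : 'I_(l i)), j = 0 :> nat -> inhabited (E i j).
Arguments inhE : clear implicits.

Let Slices := {dffun forall i : 'I_n, 'I_(l i)}.
Let X := prodpo (fun i => osum (fun j => opow (E i j))).
Let Xs (s : Slices) := prodpo (fun i => opow (E i (s i))).
Let W (s : Slices) := width (Xs s).

Let linE i j : is_linear (E i j) := wellorder_linear (woE i j).
Arguments linE : clear implicits.
Let linP i j : is_linear (opow (E i j)) := opow_linear (linE i j).
Arguments linP : clear implicits.

Lemma ground_upper : wle (\big[nsum/ozero]_(s in Gr l) W s) (fun _ : X => True).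
Proof.
have [emb Hemb] := exists_pow_emb linE decE.
rewrite -big_filter.
apply: (@wle_bigunion _ _ _ (fun (s : Slices) (x : X) => exists m, forall i, tag (x i) = s i + m :> nat)).
  move=> s _; have [[HW _] _] := width_prod_opow (fun i => woE i (s i)).
  pose phi (x : X) : Xs s := fun i => emb i (s i) (tag (x i)) (tagged (x i)).
  apply: (wle_morph (f := phi) _ (ole_refl (W s)) HW); split=> // x y [m xm] [m' ym'] xy.
  (* Points of different slices on one diagonal differ strictly, and in the same direction, in all
     tags, so incomparable points share their slice. *)
  have mm' : m = m'.
    case: xy => xy yx; have [H|H|//] := ltngtP m m'.
      by case: xy => i; have [] : plt (x i) (y i) by apply: osum_plt_tag; rewrite xm ym' ltn_add2l.
    by case: yx => i; have [] : plt (y i) (x i) by apply: osum_plt_tag; rewrite xm ym' ltn_add2l.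
  have refl (u v : X) : (forall i, tag (u i) = s i + m :> nat) ->
      (forall i, tag (v i) = s i + m :> nat) -> ple (phi u) (phi v) -> ple u v.
    move=> Hu Hv H i; have := H i; rewrite /phi.
    have uv : tag (u i) = tag (v i) by apply: val_inj; rewrite /= Hu Hv.
    have su : s i <= tag (u i) by rewrite Hu leq_addr.
    case: (u i) (v i) uv su => [j a] [k b] jk sj; have {}jk : j = k := jk; subst k.
    rewrite osum_ple //; apply: (@mono_reflect _ _ (fun=> True)) => // c d _ _.
    exact: Hemb.
  by subst m'; case: xy => xy yx; split=> H; [apply: xy|apply: yx]; apply: refl H.
(* Subtracting the least tag from all tags leads down the diagonal to a slice of [Gr]. *)
move=> x _; have [i0 _ i0_min] := arg_minnP (fun i => tag (x i) : nat) (isT : xpredT (Ordinal n_gt0)).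
have lt_l i : tag (x i) - tag (x i0) < l i by apply: leq_ltn_trans (leq_subr _ _) (ltn_ord _).
pose s : Slices := [ffun i : 'I_n => Ordinal (lt_l i)].
exists s; last by exists (tag (x i0)) => i; rewrite ffunE /= subnK // i0_min.
rewrite mem_filter mem_index_enum andbT inE; apply/existsP; exists i0.
by rewrite ffunE /= subnn.
Qed.

Lemma width_slice_antitone (s t : Slices) : (forall i, s i <= t i) -> ole (W t) (W s).
Proof.
move=> st; have [emb Hemb] := exists_pow_emb linE decE.
have [[HWs _] _] := width_prod_opow (fun i => woE i (s i)).
have [[_ HWt] _] := width_prod_opow (fun i => woE i (t i)).
apply: wge_wle HWt (wle_morph (f := (fun x i => emb i (s i) (t i) (x i)) : Xs t -> Xs s) _ (ole_refl (W s)) HWs).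
apply: reflect_incmorph => // x y _ _ H i; have := H i.
apply: (@mono_reflect _ _ (fun=> True)) => // c d _ _.
exact: Hemb.
Qed.

(** The sum of the coordinates measures the distance from the origin. The relation is boolean so
    that [sort] applies to it. *)
Let before (s t : Slices) : bool :=
  asbool (olt (W s) (W t) \/ oeq (W s) (W t) /\ \sum_i t i <= \sum_i s i).

Lemma before_total : total before.
Proof.
move=> s t; apply/orP.
have [H|H] := ole_or_olt (W s) (W t); last by right; apply/asboolP; left.
have [H'|H'] := ole_or_olt (W t) (W s); last by left; apply/asboolP; left.
have [st|st] := leqP (\sum_i s i) (\sum_i t i).
  by right; apply/asboolP; right; split.
by left; apply/asboolP; right; split=> //; apply: ltnW.
Qed.

Lemma before_trans : ssrbool.transitive before.
Proof.
move=> t s u /asboolP st /asboolP tu; apply/asboolP.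
case: st tu => [st|[st Hst]] [tu|[tu Htu]].
- by left; apply: olt_ole_trans st (olt_ole tu).
- by left; rewrite -tu.
- by left; rewrite st.
- by right; split; [rewrite st|apply: leq_trans Hst].
Qed.

(** If [s] were below [t] in every coordinate, then [W t] would be at most [W s]; the widths would
    agree, and the strictly smaller sum of [s] would contradict the tie-break. *)
Lemma before_not_le s t : before s t -> s != t -> exists i, t i < s i.
Proof.
move=> /asboolP st nst; apply: NNPP => N.
have le i : s i <= t i by rewrite leqNgt; apply/negP => H; case: N; exists i.
have Wts := width_slice_antitone le.
case: st => [st|[_]]; first by case: (olt_irr (olt_ole_trans st Wts)).
have [i nsi] : exists i, s i != t i.
  apply: NNPP => M; move/eqP: nst; apply; apply/ffunP => i.
  by apply/eqP/negPn/negP => H; case: M; exists i.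
apply/negP; rewrite -ltnNge (bigD1 i) //= [X in _ < X](bigD1 i) //= -addSn.
by apply: leq_add; [rewrite ltn_neqAle nsi le|apply: leq_sum].
Qed.

(** Distinctness and membership in [Gr] are part of the relation because [wge_stack] passes nothing
    else about the two slices to the residual condition. *)
Let r (s t : Slices) := [&& before s t, s != t, s \in Gr l & t \in Gr l].

Lemma ground_residual (t : Slices) (Y : seq X) :
  (forall y, List.In y Y -> exists2 s, r s t & forall i, tag (y i) = s i) ->
  wge (W t) (fun x : X => (forall i, tag (x i) = t i) /\ incomp_seq Y x).
Proof.
move=> HY; have H i : {g : opow (E i (t i)) -> osum (fun j => opow (E i j)) |
   [/\ forall x, tag (g x) = t i, forall x y, plt x y -> plt (g x) (g y) &
     t i = 0 :> nat -> forall x y, List.In y Y -> tag (y i) = t i -> plt (y i) (g x)]}.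
  apply: constructive_indefinite_description.
  (* Only the coordinates with [t i = 0] are shifted; there [inhE] gives the exponent that
     [opow_shift] needs. *)
  have [t0|t0] := eqVneq (t i : nat) 0; last first.
    exists (fun x => existT _ (t i) x); split=> // [x y|ti0]; last by rewrite ti0 in t0.
    by rewrite osum_plt.
  have [f0] := inhE i (t i) t0.
  have [Z HZ] := osum_component (t i) [seq y i | y : X <- Y].
  have [//|g [_ gmono gZ]] := @opow_shift _ f0 None Z (linE i (t i)) Logic.I.
  exists (fun x => existT _ (t i) (g x)); split=> // [x y /gmono|_ x y yY yt].
    by rewrite osum_plt.
  have [|z zZ ->] := HZ (y i) _ yt; first by apply/List.in_map_iff; exists y.
  by rewrite osum_plt //; apply: gZ.
pose g i := sval (H i); pose psi (x : Xs t) : X := fun i => g i (x i).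
have gtag i x : tag (g i x) = t i by case: (proj2_sig (H i)) => + _ _; apply.
have gmono i x y : plt x y -> plt (g i x) (g i y) by case: (proj2_sig (H i)) => _ + _; apply.
have gY i x y : t i = 0 :> nat -> List.In y Y -> tag (y i) = t i -> plt (y i) (g i x).
  by case: (proj2_sig (H i)) => _ _ + t0 yY yt; apply.
have [[_ HW] _] := width_prod_opow (fun i => woE i (t i)).
apply: (wge_morph (f := psi) _ (ole_refl (W t)) HW); apply: reflect_incmorph => [x _|x y _ _ K i]; last first.
  by have := K i; apply: (@mono_reflect _ _ (fun=> True)) => // c d _ _; apply: gmono.
split=> [i|y yY]; first exact: gtag.
have [s /and4P[bst nst Gs Gt] ys] := HY y yY.
have [i ti] := before_not_le bst nst.
(* Either the tags already put [y] below in some coordinate, or [t] is at most [s] everywhere. In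
   the latter case a coordinate where [s] vanishes is one where [t] vanishes too, and the shift
   there passes [y]. *)
have [k yk] : exists k, plt (y k) (psi x k).
  have [[k sk]|N] := classic (exists k, s k < t k).
    by exists k; apply: osum_plt_tag; rewrite ys gtag.
  move: Gs; rewrite inE => /existsP[k /eqP sk]; exists k.
  have tk : t k = 0 :> nat.
    by apply/eqP; rewrite -leqn0 -sk leqNgt; apply/negP => K; case: N; exists k.
  by apply: gY => //; rewrite ys; apply: val_inj; rewrite /= sk tk.
split=> K; last by case: yk => _; apply; apply: K.
by have [_] : plt (psi x i) (y i); [apply: osum_plt_tag; rewrite gtag ys|apply; apply: K].
Qed.

Lemma ground_lower : wge (\big[nsum/ozero]_(s in Gr l) W s) (fun _ : X => True).
Proof.
rewrite -big_filter; set ks := filter _ _.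
have := @wge_stack _ W X (fun s x => forall i, tag (x i) = s i) r (sort before ks).
move=> /(_ _ _ ground_residual _) H.
apply: wge_sub (H _ _ _) => //.
- by case: (big_nsum_perm W (introT permPl (perm_sort before ks))).
- by move=> s; case: (width_prod_opow (fun i => woE i (s i))).
- by move=> s t /and4P[/asboolP[/olt_ole|[[]]]].
(* Sorting gives [before] for all ordered pairs by transitivity, and the absence of repetitions
   gives distinctness. *)
have : pairwise [rel s t | before s t && (s != t)] (sort before ks).
  rewrite pairwise_relI -uniq_pairwise sort_uniq filter_uniq ?index_enum_uniq // andbT.
  rewrite -sorted_pairwise; [exact: sort_sorted before_total _|exact: before_trans].
apply: (@sub_in_pairwise _ (mem (Gr l))).
  by move=> s t Gs Gt /andP[H1 H2]; apply/and4P.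
by rewrite all_sort; apply/allP => s; rewrite mem_filter => /andP[].
Qed.
End GroundSlices.

(** If the leading exponent were zero, all exponents would be, every summand would be a single
    point, and [l + 1] distinct elements of [A] would inject into [l] tags. *)
Lemma leading_exponent_inhabited (A : POrd) (l : nat) (E : 'I_l -> POrd) (j : 'I_l) :
  infinite_po A -> po_iso A (osum (fun k => opow (E k))) ->
  (forall k : 'I_l, j <= k -> ord_le (E k) (E j)) -> j = 0 :> nat -> inhabited (E j).
Proof.
move=> [h hI] [f [[f' fK f'K] _]] dec j0; apply: NNPP => N.
have triv k (x y : opow (E k)) : x = y.
  have [g _] : ord_le (E k) (E j) by apply: dec; rewrite j0.
  apply: opow_val_inj; case: (sval x) => [|e s]; last by case: N; split; apply: g e.
  by case: (sval y) => // e s; case: N; split; apply: g e.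
have inj : injective (fun m : 'I_l.+1 => tag (f (h m))).
  move=> m m' /= E1; apply/val_inj/hI/(can_inj fK).
  by case: (f _) (f _) E1 => [k x] [k' y] /= E1; subst k'; rewrite (triv k x y).
by have := leq_card _ inj; rewrite !card_ord ltnn.
Qed.

Unset Implicit Arguments.

Theorem mainTheorem11 (n : nat) (alpha : 'I_n -> POrd) (l : 'I_n -> nat)
    (E : forall i : 'I_n, 'I_(l i) -> POrd) :
  (0 < n)%N ->
  (forall i, is_wellorder (alpha i)) ->
  (forall i, infinite_po (alpha i)) ->
  (forall i j, is_wellorder (E i j)) ->
  (forall i (j k : 'I_(l i)), (j <= k)%N -> ord_le (E i k) (E i j)) ->
  (forall i, po_iso (alpha i) (osum (fun j => opow (E i j)))) ->
  oeq (width (prodpo alpha))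
      (\big[nsum/ozero]_(s in Gr l)
          width (prodpo (fun i => opow (E i (s i))))).
Proof.
move=> n_gt0 woA infA woE decE iso; apply: width_wval.
have inhE i (j : 'I_(l i)) : j = 0 :> nat -> inhabited (E i j).
  by apply: leading_exponent_inhabited (infA i) (iso i) (decE i j).
have H i : {f : (alpha i -> osum (fun j => opow (E i j))) * (osum (fun j => opow (E i j)) -> alpha i) |
    cancel f.2 f.1 /\ forall x y, ple x y <-> ple (f.1 x) (f.1 y)}.
  apply: constructive_indefinite_description.
  by have [f [[f' fK f'K] Hf]] := iso i; exists (f, f').
pose f i := (sval (H i)).1; pose f' i := (sval (H i)).2.
have fP i x y : ple x y <-> ple (f i x) (f i y) by case: (proj2_sig (H i)) => _ ->.
have f'K i : cancel (f' i) (f i) by case: (proj2_sig (H i)).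
pose X := prodpo (fun i => osum (fun j => opow (E i j))).
pose phi (x : prodpo alpha) : X := fun i => f i (x i).
pose psi (x : X) : prodpo alpha := fun i => f' i (x i).
split.
  (* The upper bound is pulled back along the isomorphisms of the factors, the lower bound pushed
     forward along their inverses. *)
  apply: (wle_morph (f := phi) _ (ole_refl _) (ground_upper n_gt0 woE decE)).
  by apply: reflect_incmorph => // x y _ _ K i; apply/fP.
apply: (wge_morph (f := psi) _ (ole_refl _) (ground_lower woE decE inhE)).
by apply: reflect_incmorph => // x y _ _ K i; have /fP := K i; rewrite !f'K.
Qed.
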